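(* Let $u_h\in C^2([0,\infty);\tilde H^2_0(0,L))$ and $\tilde\zeta_1,\tilde\zeta_2\in C^1([0,\infty);\mathbb{R}^r)$ solve the semi-discrete Galerkin system in $W_h$ (as defined in the context). Then for $t>0$: $$\frac{d}{dt}E(t;u_h,\tilde\zeta_1,\tilde\zeta_2)=-\frac{\epsilon_1}{2}\tilde\zeta_1^\top P_1\tilde\zeta_1-\frac12\left(\tilde\zeta_1\cdot q_1+\tilde\delta_1(u_h)_{xt}(L)\right)^2-\delta_1(u_h)_{xt}(L)^2$$ $$\qquad-\frac{\epsilon_2}{2}\tilde\zeta_2^\top P_2\tilde\zeta_2-\frac12\left(\tilde\zeta_2\cdot q_2+\tilde\delta_2(u_h)_t(L)\right)^2-\delta_2(u_h)_t(L)^2\le0.$$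
   Context: Coefficients. Fix $L>0$, an integer $r\ge1$, constants $M,J,k_1,k_2>0$, and strictly positive functions $\mu,\Lambda\in C^4[0,L]$. For $j=1,2$ let $A_j\in\mathbb{R}^{r\times r}$ be Hurwitz (all eigenvalues have negative real part), $b_j,c_j\in\mathbb{R}^r$, and $d_j,\delta_j\in\mathbb{R}$ such that the transfer function $\mathcal{G}_j(s)=\big((s\,\mathrm{Id}-A_j)^{-1}b_j\big)\cdot c_j+d_j$ satisfies $\operatorname{Re}\mathcal{G}_j(i\omega)\ge d_j\ge\delta_j>0$ for all $\omega\ge0$. Fix symmetric positive definite matrices $P_j\in\mathbb{R}^{r\times r}$, scalars $\epsilon_j>0$ and vectors $q_j\in\mathbb{R}^r$ (existing by the Kalman–Yakubovich–Popov lemma) with $P_jA_j+A_j^\top P_j=-q_jq_j^\top-\epsilon_jP_j$ and $P_jb_j=c_j-q_j\sqrt{2(d_j-\delta_j)}$, $j=1,2$. Set $\tilde\delta_j=\sqrt{2(d_j-\delta_j)}$. $\tilde H^2_0(0,L):=\{u\in H^2(0,L):u(0)=u_x(0)=0\}$. Semi-discrete system. Let $W_h\subset\tilde H^2_0(0,L)$ be a finite dimensional subspace with basis $w_1,\dots,w_N$. A solution consists of $u_h\in C^2([0,\infty);W_h)$ and $\tilde\zeta_1,\tilde\zeta_2\in C^1([0,\infty);\mathbb{R}^r)$ such that for $j=1,\dots,N$ and $t>0$ $$\int_0^L\mu(u_h)_{tt}w_j\,dx+\int_0^L\Lambda(u_h)_{xx}(w_j)_{xx}\,dx+M(u_h)_{tt}(t,L)w_j(L)+J(u_h)_{xtt}(t,L)(w_j)_x(L)$$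 $$+k_1(u_h)_x(t,L)(w_j)_x(L)+k_2u_h(t,L)w_j(L)+d_1(u_h)_{xt}(t,L)(w_j)_x(L)+d_2(u_h)_t(t,L)w_j(L)$$ $$+c_1\cdot\tilde\zeta_1(t)\,(w_j)_x(L)+c_2\cdot\tilde\zeta_2(t)\,w_j(L)=0,$$ $$(\tilde\zeta_1)_t(t)=A_1\tilde\zeta_1(t)+b_1(u_h)_{xt}(t,L),\qquad(\tilde\zeta_2)_t(t)=A_2\tilde\zeta_2(t)+b_2(u_h)_t(t,L).$$ Energy functional. For $u\in C^2([0,\infty);\tilde H^2_0(0,L))$ and $\zeta_1,\zeta_2\in C^1([0,\infty);\mathbb{R}^r)$, $$E(t;u,\zeta_1,\zeta_2):=\frac12\int_0^L\left(\Lambda u_{xx}(t,x)^2+\mu u_t(t,x)^2\right)dx+\frac M2u_t(t,L)^2+\frac J2u_{xt}(t,L)^2+\frac{k_1}2u_x(t,L)^2+\frac{k_2}2u(t,L)^2+\frac12\zeta_1^\top(t)P_1\zeta_1(t)+\frac12\zeta_2^\top(t)P_2\zeta_2(t).$$ *)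

(* Defs.v *)
From HB Require Import structures.
From mathcomp Require Import all_boot all_order all_algebra.
From mathcomp Require Import all_classical all_reals all_analysis.
From mathcomp Require Import complex.

Set Implicit Arguments.
Unset Strict Implicit.
Unset Printing Implicit Defensive.

Import Order.TTheory GRing.Theory Num.Theory.
Import numFieldNormedType.Exports.

Local Open Scope classical_set_scope.
Local Open Scope ring_scope.
Local Open Scope complex_scope.

(* f \in C^k[0, L]: the derivatives g 1, ..., g k of f on the open interval
   extend continuously to the closed one. *)
Definition Ck_closed (R : realType) (L : R) (k : nat) (f : R -> R) : Prop :=
  exists g : nat -> R -> R,
    [/\ {in `[0, L], f =1 g 0%N},
        forall i, (i <= k)%N -> {within `[0, L], continuous (g i)} &
        forall i, (i < k)%N -> forall x : R, x \in `]0, L[ ->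
          is_derive x 1 (g i) (g i.+1 x)].

Definition test_function (R : realType) (L : R) (phi : R -> R) : Prop :=
  [/\ forall (n : nat) (x : R), derivable (derive1n n phi) x 1,
      compact (closure [set x | phi x != 0]) &
      closure [set x | phi x != 0] `<=` `]0, L[].

Definition L2 (R : realType) (L : R) (f : R -> R) : Prop :=
  (f \_ `]0, L[) \in Lfun (@lebesgue_measure R) 2%:E.

Definition weak_derivative (R : realType) (L : R) (f g : R -> R) : Prop :=
  forall phi, test_function L phi ->
    \int[lebesgue_measure]_(x in `]0, L[) (f x * derive1 phi x) =
    - \int[lebesgue_measure]_(x in `]0, L[) (g x * phi x).

(* An element of H^2(0, L) is carried together with its weak derivatives, as a
   triple (u, u_x, u_xx).  The first two components are the continuous
   representatives on [0, L], so that point values at 0 and L make sense; the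
   third one only matters up to a null set. *)
Definition jet (R : realType) : Type := ((R -> R) * (R -> R) * (R -> R))%type.

Definition fn (R : realType) (v : jet R) : R -> R := v.1.1.
Definition dx (R : realType) (v : jet R) : R -> R := v.1.2.
Definition dxx (R : realType) (v : jet R) : R -> R := v.2.

Record H2 (R : realType) (L : R) (v : jet R) : Prop := {
  H2_fn_L2 : L2 L (fn v);
  H2_dx_L2 : L2 L (dx v);
  H2_dxx_L2 : L2 L (dxx v);
  H2_dx_weak : weak_derivative L (fn v) (dx v);
  H2_dxx_weak : weak_derivative L (dx v) (dxx v);
  H2_fn_continuous : {within `[0, L], continuous (fn v)};
  H2_dx_continuous : {within `[0, L], continuous (dx v)}
}.

Definition H20 (R : realType) (L : R) : set (jet R) :=
  [set v | [/\ H2 L v, fn v 0 = 0 & dx v 0 = 0]].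

Definition normH2 (R : realType) (L : R) (v : jet R) : R :=
  Num.sqrt (\int[lebesgue_measure]_(x in `]0, L[) (fn v x ^+ 2) +
            \int[lebesgue_measure]_(x in `]0, L[) (dx v x ^+ 2) +
            \int[lebesgue_measure]_(x in `]0, L[) (dxx v x ^+ 2)).

(* Two triples in H20 represent the same element of the function space iff
   their difference has zero norm. *)
Definition galerkin_basis (R : realType) (L : R) (N : nat)
    (w : 'I_N -> jet R) : Prop :=
  (forall j, H20 L (w j)) /\
  (forall a : 'I_N -> R,
     normH2 L (\sum_(j < N) a j *: w j) = 0 -> forall j, a j = 0).

Definition galerkin_space (R : realType) (L : R) (N : nat)
    (w : 'I_N -> jet R) : set (jet R) :=
  [set v | H20 L v /\
     exists a : 'I_N -> R, normH2 L (v - \sum_(j < N) a j *: w j) = 0].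

(* Curves on [0, oo) in a subset S of a space V with the seminorm nrm.
   At t = 0 the derivative is one-sided; values at negative times are
   irrelevant. *)

Definition has_time_derivative (R : realType) (V : lmodType R) (nrm : V -> R)
    (f f' : R -> V) : Prop :=
  forall t : R, 0 <= t ->
    nrm (h^-1 *: (f (t + h) - f t) - f' t)
      @[h --> within [set h | 0 <= t + h] 0^'] --> (0 : R).

Definition time_continuous (R : realType) (V : lmodType R) (nrm : V -> R)
    (f : R -> V) : Prop :=
  forall t : R, 0 <= t ->
    nrm (f s - f t) @[s --> within [set s | 0 <= s] (nbhs t)] --> (0 : R).

Definition C1_curve (R : realType) (V : lmodType R) (nrm : V -> R) (S : set V)
    (f f' : R -> V) : Prop :=
  [/\ forall t : R, 0 <= t -> S (f t) /\ S (f' t),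
      has_time_derivative nrm f f' & time_continuous nrm f'].

Definition C2_curve (R : realType) (V : lmodType R) (nrm : V -> R) (S : set V)
    (f f' f'' : R -> V) : Prop :=
  C1_curve nrm S f f' /\ C1_curve nrm S f' f''.

Definition dot (K : pzRingType) (r : nat) (x y : 'cV[K]_r) : K :=
  \sum_(i < r) x i 0 * y i 0.

Definition norm2 (R : realType) (r : nat) (x : 'cV[R]_r) : R :=
  Num.sqrt (dot x x).

Record beam (R : realType) := Beam {
  len : R;
  tipM : R;
  tipJ : R;
  k1 : R;
  k2 : R;
  mu : R -> R;
  Lam : R -> R
}.

Record beam_ok (R : realType) (B : beam R) : Prop := {
  len_gt0 : 0 < len B;
  tipM_gt0 : 0 < tipM B;
  tipJ_gt0 : 0 < tipJ B;
  k1_gt0 : 0 < k1 B;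
  k2_gt0 : 0 < k2 B;
  mu_C4 : Ck_closed (len B) 4 (mu B);
  Lam_C4 : Ck_closed (len B) 4 (Lam B);
  mu_gt0 : forall x : R, x \in `[0, len B] -> 0 < mu B x;
  Lam_gt0 : forall x : R, x \in `[0, len B] -> 0 < Lam B x
}.

Record controller (R : realType) (r : nat) := Controller {
  cA : 'M[R]_r;
  cb : 'cV[R]_r;
  cc : 'cV[R]_r;
  cd : R;
  cdelta : R;
  cP : 'M[R]_r;
  ceps : R;
  cq : 'cV[R]_r
}.

Definition cdeltat (R : realType) (r : nat) (C : controller R r) : R :=
  Num.sqrt (2 * (cd C - cdelta C)).

Definition hurwitz (R : realType) (r : nat) (A : 'M[R]_r) : Prop :=
  forall z : R[i], eigenvalue (map_mx (real_complex R) A) z ->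
    complex.Re z < 0.

Definition transfer (R : realType) (r : nat) (C : controller R r)
    (s : R[i]) : R[i] :=
  dot (invmx (s%:M - map_mx (real_complex R) (cA C))
         *m map_mx (real_complex R) (cb C))
      (map_mx (real_complex R) (cc C)) + (cd C)%:C.

Record controller_ok (R : realType) (r : nat) (C : controller R r) : Prop := {
  cA_hurwitz : hurwitz (cA C);
  transfer_ge : forall omega : R, 0 <= omega ->
    cd C <= complex.Re (transfer C (0 +i* omega));
  cd_ge : cdelta C <= cd C;
  cdelta_gt0 : 0 < cdelta C;
  cP_sym : (cP C)^T = cP C;
  cP_posdef : forall x : 'cV[R]_r, x != 0 -> 0 < dot x (cP C *m x);
  ceps_gt0 : 0 < ceps C;
  cP_lyapunov : cP C *m cA C + (cA C)^T *m cP C =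
    - (cq C *m (cq C)^T) - ceps C *: cP C;
  cP_b : cP C *m cb C = cc C - cdeltat C *: cq C
}.

(* A curve u in H20 comes with its time
   derivatives ut and utt, which are curves of triples: e.g. dx (ut t) L is
   u_xt(t, L). *)

Record semidiscrete_solution (R : realType) (r N : nat) (B : beam R)
    (C1 C2 : controller R r) (w : 'I_N -> jet R)
    (u ut utt : R -> jet R) (z1 z1t z2 z2t : R -> 'cV[R]_r) : Prop := {
  sol_u : C2_curve (normH2 (len B)) (galerkin_space (len B) w) u ut utt;
  sol_z1 : C1_curve (@norm2 R r) setT z1 z1t;
  sol_z2 : C1_curve (@norm2 R r) setT z2 z2t;
  sol_eq : forall (j : 'I_N) (t : R), 0 < t ->
    let L := len B in
    \int[lebesgue_measure]_(x in `]0, L[) (mu B x * fn (utt t) x * fn (w j) x)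
    + \int[lebesgue_measure]_(x in `]0, L[)
        (Lam B x * dxx (u t) x * dxx (w j) x)
    + tipM B * fn (utt t) L * fn (w j) L
    + tipJ B * dx (utt t) L * dx (w j) L
    + k1 B * dx (u t) L * dx (w j) L
    + k2 B * fn (u t) L * fn (w j) L
    + cd C1 * dx (ut t) L * dx (w j) L
    + cd C2 * fn (ut t) L * fn (w j) L
    + dot (cc C1) (z1 t) * dx (w j) L
    + dot (cc C2) (z2 t) * fn (w j) L = 0;
  sol_ode1 : forall t : R, 0 < t ->
    z1t t = cA C1 *m z1 t + dx (ut t) (len B) *: cb C1;
  sol_ode2 : forall t : R, 0 < t ->
    z2t t = cA C2 *m z2 t + fn (ut t) (len B) *: cb C2
}.

Definition energy (R : realType) (r : nat) (B : beam R)
    (C1 C2 : controller R r) (u ut : R -> jet R) (z1 z2 : R -> 'cV[R]_r)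
    (t : R) : R :=
  let L := len B in
  2^-1 * \int[lebesgue_measure]_(x in `]0, L[)
           (Lam B x * dxx (u t) x ^+ 2 + mu B x * fn (ut t) x ^+ 2)
  + tipM B / 2 * fn (ut t) L ^+ 2
  + tipJ B / 2 * dx (ut t) L ^+ 2
  + k1 B / 2 * dx (u t) L ^+ 2
  + k2 B / 2 * fn (u t) L ^+ 2
  + 2^-1 * dot (z1 t) (cP C1 *m z1 t)
  + 2^-1 * dot (z2 t) (cP C2 *m z2 t).

(* Main.v *)
Require Import Defs.
From mathcomp Require Import all_boot all_order all_algebra.
From mathcomp Require Import all_classical all_reals all_analysis.
From mathcomp Require Import measurable_realfun ring lra.
Import Order.TTheory GRing.Theory Num.Theory.
Import numFieldNormedType.Exports.
Local Open Scope classical_set_scope.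
Local Open Scope ring_scope.

(** The energy is half the sum of four nonnegative quadratic forms evaluated
    along curves: the stiffness form at [u], the mass form at [ut], and the
    storage forms [z^T P z] of the two controllers.  For a symmetric form [q]
    that is bounded with respect to the norm in which the curve [f] is
    differentiable, [q (f, f)] has derivative [2 q (f, f')]
    ([is_derive_psd_form]), so

      [E' = stiffness (u, ut) + mass (ut, utt) + z1^T P1 z1' + z2^T P2 z2'].

    Testing the Galerkin equation with [ut t], which lies in the discrete space,
    turns the first two terms into the boundary damping and coupling terms
    ([galerkin_Wh]); by the Lyapunov equation and the relation for [P b], the
    coupling cancels against the last two terms and completes the squares of the
    stated rate ([storage_rate]).

    The analytic point is the boundedness of the forms, since they contain the
    values at the tip [x = L], whereas differentiability in time is only known
    in the norm of H^2.  Boundedness comes from the finite dimension of the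
    discrete space: a form that vanishes on the elements of zero norm is
    automatically bounded there ([span_mod_bounded]).  The
    coordinates of an element are recovered from its inner products with the
    basis by the inverse of the Gram matrix, and these inner products are
    controlled by Cauchy-Schwarz.  It remains that zero norm forces
    zero tip values ([null_end]), which is continuity up to the boundary.

    Elements of H^2 are triples of functions that the norm only determines up
    to null sets, so the norm is a seminorm.  All the linear algebra is
    therefore carried out for positive semidefinite forms, and identities
    involving basis coordinates hold modulo the null space of the inner
    product. *)

Set Implicit Arguments.
Unset Strict Implicit.
Unset Printing Implicit Defensive.

(** * Positive semidefinite forms on a linear subspace *)

Definition lin_closed (R : realType) (V : lmodType R) (S : set V) : Prop :=
  S 0 /\ forall (a : R) u v, S u -> S v -> S (a *: u + v).

(** Linearity is only required on a subset, since the integrals below are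
    additive only on square-integrable functions. *)
Definition linear_on (R : realType) (V : lmodType R) (S : set V)
    (F : V -> R) : Prop :=
  forall (a : R) u v, S u -> S v -> F (a *: u + v) = a * F u + F v.

Record psd_form (R : realType) (V : lmodType R) (S : set V)
    (q : V -> V -> R) : Prop := {
  psd_lin : forall u, S u -> linear_on S (q u);
  psd_sym : forall u v, S u -> S v -> q u v = q v u;
  psd_ge0 : forall u, S u -> 0 <= q u u
}.

Section Forms.
Context (R : realType) (V : lmodType R).
Implicit Types (S : set V) (F : V -> R) (q : V -> V -> R).

Lemma lin_closedD S u v : lin_closed S -> S u -> S v -> S (u + v).
Proof. by move=> [_ SL] Su Sv; rewrite -[u]scale1r; exact: SL. Qed.

Lemma lin_closedZ S a u : lin_closed S -> S u -> S (a *: u).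
Proof. by move=> [S0 SL] Su; rewrite -[_ *: _]addr0; exact: SL. Qed.

Lemma lin_closedB S u v : lin_closed S -> S u -> S v -> S (u - v).
Proof. by move=> [_ SL] Su Sv; rewrite addrC -scaleN1r; exact: SL. Qed.

Lemma lin_closed_sum S N (a : 'I_N -> R) (w : 'I_N -> V) :
  lin_closed S -> (forall j, S (w j)) -> S (\sum_(j < N) a j *: w j).
Proof.
move=> SL Sw; elim/big_ind: _ => [|u v|j _]; first exact: SL.1.
  exact: lin_closedD.
exact: lin_closedZ.
Qed.

Lemma linear_onD S F u v :
  linear_on S F -> S u -> S v -> F (u + v) = F u + F v.
Proof. by move=> FL Su Sv; rewrite -{1}[u]scale1r FL// mul1r. Qed.

Lemma linear_on0 S F : lin_closed S -> linear_on S F -> F 0 = 0.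
Proof.
move=> [S0 _] FL; apply/(addrI (F 0)).
by rewrite -(linear_onD FL)// !addr0.
Qed.

Lemma linear_onZ S F a u :
  lin_closed S -> linear_on S F -> S u -> F (a *: u) = a * F u.
Proof.
move=> SL FL Su; rewrite -[a *: u]addr0 FL ?(linear_on0 SL FL) ?addr0//.
exact: SL.1.
Qed.

Lemma linear_onB S F u v :
  linear_on S F -> S u -> S v -> F (u - v) = F u - F v.
Proof. by move=> FL Su Sv; rewrite addrC -scaleN1r FL// mulN1r addrC. Qed.

Lemma linear_on_sum S F N (a : 'I_N -> R) (w : 'I_N -> V) :
  lin_closed S -> linear_on S F -> (forall j, S (w j)) ->
  F (\sum_(j < N) a j *: w j) = \sum_(j < N) a j * F (w j).
Proof.
move=> SL FL Sw.
suff [] : S (\sum_(j < N) a j *: w j) /\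
    F (\sum_(j < N) a j *: w j) = \sum_(j < N) a j * F (w j) by [].
elim/big_ind2: _ => [|u x v y [Su <-] [Sv <-]|j _].
- by split; [exact: SL.1|exact: linear_on0 FL].
- by split; [exact: lin_closedD|exact: (linear_onD FL)].
- by split; [exact: lin_closedZ|exact: (linear_onZ _ SL FL)].
Qed.

Lemma linear_on_sub S S' F : S' `<=` S -> linear_on S F -> linear_on S' F.
Proof. by move=> sub FL a u v /sub Su /sub Sv; exact: FL. Qed.

Lemma psd_form_sub S S' q : S' `<=` S -> psd_form S q -> psd_form S' q.
Proof.
move=> sub [ql qs q0]; split=> [u /sub Su|u v /sub Su /sub Sv|u /sub Su].
- exact: linear_on_sub sub (ql _ Su).
- exact: qs.
- exact: q0.
Qed.

Lemma psd_formD S q1 q2 : psd_form S q1 -> psd_form S q2 ->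
  psd_form S (fun u v => q1 u v + q2 u v).
Proof.
move=> [l1 s1 p1] [l2 s2 p2]; split=> [u Su a v w Sv Sw|u v Su Sv|u Su].
- by rewrite l1// l2//; ring.
- by rewrite s1// s2.
- by rewrite addr_ge0 ?p1 ?p2.
Qed.

Lemma psd_form_sqr S F (c : R) : 0 <= c -> linear_on S F ->
  psd_form S (fun u v => c * F u * F v).
Proof.
move=> c0 FL; split=> [u Su a v w Sv Sw|u v Su Sv|u Su].
- by rewrite FL//; ring.
- by ring.
- by rewrite -mulrA mulr_ge0// -expr2 sqr_ge0.
Qed.

Lemma psd_form_quad S q (a : R) u v : lin_closed S -> psd_form S q ->
  S u -> S v ->
  q (a *: u + v) (a *: u + v) = a ^+ 2 * q u u + 2 * a * q u v + q v v.
Proof.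
move=> SL [ql qs _] Su Sv.
have Suv : S (a *: u + v) by exact: SL.2.
rewrite (ql _ Suv)// (qs _ u Suv)// (qs _ v Suv)// !ql// (qs v u)//; ring.
Qed.

(** The quadratic polynomial [a |-> q (a u + v, a u + v)] is nonnegative.  When
    [q u u] vanishes this polynomial is affine, hence constant. *)
Lemma psd_form_CS S q u v : lin_closed S -> psd_form S q -> S u -> S v ->
  q u v ^+ 2 <= q u u * q v v.
Proof.
move=> SL qP Su Sv.
have quad a : 0 <= a ^+ 2 * q u u + 2 * a * q u v + q v v.
  by rewrite -(psd_form_quad a SL qP Su Sv); apply: (psd_ge0 qP); exact: SL.2.
have := psd_ge0 qP Su; rewrite le_eqVlt => /predU1P[u0|u0].
  have [->|quv0] := eqVneq (q u v) 0; first by rewrite -u0 expr0n mul0r.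
  (* at this value of a the affine function takes the value -1 *)
  have := quad (- (q v v + 1) / (2 * q u v)).
  have -> : 2 * (- (q v v + 1) / (2 * q u v)) * q u v = - (q v v + 1).
    by field.
  by rewrite -u0 mulr0 add0r; lra.
have := quad (- q u v / q u u).
have -> : (- q u v / q u u) ^+ 2 * q u u + 2 * (- q u v / q u u) * q u v
    + q v v = (q u u * q v v - q u v ^+ 2) / q u u.
  by field; exact: lt0r_neq0.
by rewrite pmulr_lge0 ?invr_gt0// subr_ge0.
Qed.

Lemma psd_form_null S q u v : lin_closed S -> psd_form S q -> S u -> S v ->
  q u u = 0 -> q u v = 0.
Proof.
move=> SL qP Su Sv u0; have := psd_form_CS SL qP Su Sv.
rewrite u0 mul0r => le0; apply/eqP; rewrite -sqrf_eq0 eq_le le0.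
exact: sqr_ge0.
Qed.

(** The span of [w], saturated by the null space of [b]. *)
Definition span_mod S (b : V -> V -> R) (N : nat) (w : 'I_N -> V) : set V :=
  [set v | S v /\ exists a : 'I_N -> R,
    b (v - \sum_(j < N) a j *: w j) (v - \sum_(j < N) a j *: w j) = 0].

Section Span.
Context {S : set V} {b : V -> V -> R} {N : nat} {w : 'I_N -> V}.
Hypotheses (SL : lin_closed S) (bP : psd_form S b) (Sw : forall j, S (w j)).

Lemma span_mod_closed : lin_closed (span_mod S b w).
Proof.
split.
  split; first exact: SL.1.
  exists (fun=> 0); rewrite big1 ?subr0; last by move=> j _; rewrite scale0r.
  apply: (linear_on0 SL); apply: (psd_lin bP); exact: SL.1.
move=> c u v [Su [a ua]] [Sv [a' va]]; split; first exact: SL.2.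
exists (fun j => c * a j + a' j).
have -> : \sum_(j < N) (c * a j + a' j) *: w j =
    c *: (\sum_(j < N) a j *: w j) + \sum_(j < N) a' j *: w j.
  rewrite scaler_sumr -big_split; apply: eq_bigr => j _ /=.
  by rewrite scalerDl scalerA.
set s := \sum_(j < N) a j *: w j in ua *; set s' := (X in _ - (_ + X)).
have -> : c *: u + v - (c *: s + s') = c *: (u - s) + (v - s').
  by rewrite scalerBr opprD addrACA.
have Ss : S (u - s) by apply: lin_closedB => //; exact: lin_closed_sum.
have Ss' : S (v - s') by apply: lin_closedB => //; exact: lin_closed_sum.
rewrite (psd_form_quad c SL bP Ss Ss') ua va.
by rewrite (psd_form_null SL bP Ss Ss' ua) !mulr0 !addr0.
Qed.

(** How an equation tested with the basis extends to the whole space. *)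
Lemma span_mod_linear0 F v : linear_on S F -> (forall j, F (w j) = 0) ->
  (forall n, S n -> b n n = 0 -> F n = 0) -> span_mod S b w v -> F v = 0.
Proof.
move=> FL Fw Fnull [Sv [a ba]].
have Ss : S (\sum_(j < N) a j *: w j) by exact: lin_closed_sum.
have := Fnull _ (lin_closedB SL Sv Ss) ba.
rewrite (linear_onB FL Sv Ss) (linear_on_sum a SL FL Sw) big1 ?subr0//.
by move=> j _; rewrite Fw mulr0.
Qed.

Hypothesis w_indep : forall a : 'I_N -> R,
  b (\sum_(j < N) a j *: w j) (\sum_(j < N) a j *: w j) = 0 ->
  forall j, a j = 0.

Let gram : 'M[R]_N := \matrix_(i, j) b (w i) (w j).

(** A row [x] in the kernel of the Gram matrix gives
    [b (s, s) = x gram x^T = 0] for [s = \sum_j x_j w_j]. *)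
Lemma gram_unit : gram \in unitmx.
Proof.
rewrite -row_free_unit -kermx_eq0; apply/eqP/row_matrixP => i.
rewrite row0; set x := row i (kermx gram).
have xg : x *m gram = 0.
  by rewrite /x -row_mul mulmx_ker row0.
(* forget that x is a row of the kernel, lest mxE unfold its entries *)
move: x xg => x xg.
suff x0 : forall j, x 0 j = 0 by apply/rowP => j; rewrite x0 mxE.
apply: (@w_indep (fun j => x 0 j)).
have Ss : S (\sum_(j < N) x 0 j *: w j) by exact: lin_closed_sum.
rewrite (linear_on_sum _ SL (psd_lin bP Ss) Sw) big1// => k _.
rewrite (psd_sym bP)// (linear_on_sum _ SL (psd_lin bP (Sw k)) Sw).
have <- : (x *m gram) 0 k = \sum_j x 0 j * b (w k) (w j).
  by rewrite mxE; apply: eq_bigr => l _; rewrite [gram _ _]mxE (psd_sym bP).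
by rewrite xg mxE mulr0.
Qed.

(** On a finite-dimensional space any form that does not see the null space of
    [b] is bounded by [b].  Modulo the null space, [v] has coordinates
    [a = (b (v, w_k))_k gram^-1], so each of them is at most a constant multiple
    of the norm of [v], by Cauchy-Schwarz. *)
Lemma span_mod_bounded q : psd_form S q ->
  (forall n, S n -> b n n = 0 -> q n n = 0) ->
  exists2 C : R, 0 <= C &
    forall v, span_mod S b w v -> q v v <= C * b v v.
Proof.
move=> qP qnull.
pose K (j : 'I_N) : R := \sum_k Num.sqrt (b (w k) (w k)) * `|invmx gram k j|.
have K0 j : 0 <= K j by apply: sumr_ge0 => k _; rewrite mulr_ge0 ?sqrtr_ge0.
exists (\sum_i \sum_j K i * K j * `|q (w i) (w j)|).
  by apply: sumr_ge0 => i _; apply: sumr_ge0 => j _; rewrite !mulr_ge0.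
move=> v [Sv [a]]; set s := \sum_(j < N) a j *: w j => bn.
have Ss : S s by exact: lin_closed_sum.
have Sn : S (v - s) by exact: lin_closedB.
have bv k : b v (w k) = \sum_j a j * gram j k.
  have := psd_form_null SL bP Sn (Sw k) bn.
  rewrite (psd_sym bP)// (linear_onB (psd_lin bP (Sw k)))// => /eqP.
  rewrite subr_eq0 (psd_sym bP (Sw k))// => /eqP ->.
  rewrite (linear_on_sum _ SL (psd_lin bP (Sw k)) Sw).
  by apply: eq_bigr => j _; rewrite mxE (psd_sym bP).
(* the coordinates of v, in terms of quantities that the norm controls *)
have aE j : a j = \sum_k b v (w k) * invmx gram k j.
  have : (\row_j a j) *m gram *m invmx gram = \row_j a j.
    by rewrite -mulmxA (mulmxV gram_unit) mulmx1.
  move=> /rowP/(_ j); rewrite !mxE => <-; apply: eq_bigr => k _.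
  by rewrite bv !mxE; congr (_ * _); apply: eq_bigr => l _; rewrite !mxE.
set m := Num.sqrt (b v v).
have m0 : 0 <= m by exact: sqrtr_ge0.
have bvE : b v v = m ^+ 2 by rewrite sqr_sqrtr// (psd_ge0 bP).
have a_le j : `|a j| <= m * K j.
  rewrite aE (le_trans (ler_norm_sum _ _ _))// mulr_sumr ler_sum// => k _.
  rewrite normrM mulrA ler_wpM2r// -sqrtr_sqr -sqrtrM ?(psd_ge0 bP)//.
  by rewrite ler_wsqrtr// (psd_form_CS SL bP).
have -> : q v v = q s s.
  have -> : v = 1 *: (v - s) + s by rewrite scale1r subrK.
  have qn := qnull _ Sn bn.
  rewrite (psd_form_quad 1 SL qP Sn Ss) qn.
  by rewrite (psd_form_null SL qP Sn Ss qn) !mulr0 !add0r.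
rewrite (linear_on_sum _ SL (psd_lin qP Ss) Sw) mulr_suml ler_sum// => i _.
rewrite (psd_sym qP)// (linear_on_sum _ SL (psd_lin qP (Sw i)) Sw).
rewrite mulr_sumr mulr_suml ler_sum// => j _.
rewrite bvE (le_trans (ler_norm _))// !normrM.
have -> : K i * K j * `|q (w i) (w j)| * m ^+ 2 =
    m * K i * (m * K j * `|q (w i) (w j)|) by ring.
by rewrite ler_pM// ?mulr_ge0// ler_wpM2r.
Qed.

End Span.
End Forms.

(** * Differentiating a quadratic form along a curve *)

(** With [e h] the error of the difference quotient of [f], one has
    [f (t + h) = f t + h (f' t + e h)], so the error of the difference quotient
    of [q (f, f)] is [2 q (f t, e h) + h q (f' t + e h, f' t + e h)].  It tends
    to zero because [q] is controlled by the norm in which [e h] does. *)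
Lemma is_derive_psd_form (R : realType) (V : lmodType R) (W : set V)
    (q : V -> V -> R) (nrm : V -> R) (C : R) (f f' : R -> V) (t : R) :
  lin_closed W -> psd_form W q -> 0 <= C ->
  (forall v, W v -> q v v <= C * nrm v ^+ 2) ->
  C1_curve nrm W f f' -> 0 < t ->
  is_derive t 1 (fun s => q (f s) (f s)) (2 * q (f t) (f' t)).
Proof.
move=> WL qP C0 q_le [Wf df _] t0.
have [Wft Wf't] := Wf t (ltW t0).
pose e h := h^-1 *: (f (t + h) - f t) - f' t.
have near_t : \forall h \near (0 : R)^', 0 <= t + h.
  apply: nbhs_dnbhs; apply/nbhs_ballP; exists t => //= h.
  by rewrite /ball/= sub0r normrN => /ltr_normlP[]; lra.
have ecvg : nrm (e h) @[h --> (0 : R)^'] --> (0 : R).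
  move=> A /(df t (ltW t0)); rewrite /nbhs/= /within/= => Ae.
  by apply: filterS2 near_t Ae => h th; apply.
pose k := Num.sqrt (q (f t) (f t) * C).
have diffE h : h != 0 -> 0 <= t + h ->
  `|h^-1 *: (q (f (t + h)) (f (t + h)) - q (f t) (f t))
    - 2 * q (f t) (f' t)|
  <= 2 * (k * `|nrm (e h)|)
    + `|h| * (2 * (q (f' t) (f' t) + C * nrm (e h) ^+ 2)).
  move=> h0 th0; have [Wfth _] := Wf _ th0.
  have We : W (e h).
    by apply: lin_closedB => //; apply: lin_closedZ => //; exact: lin_closedB.
  have Wg : W (f' t + e h) by exact: lin_closedD.
  have -> : f (t + h) = h *: (f' t + e h) + f t.
    by rewrite /e [f' t + _]addrC subrK scalerA divff// scale1r subrK.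
  rewrite (psd_form_quad h WL qP Wg Wft).
  have qfe : q (f' t + e h) (f t) = q (f t) (f' t) + q (f t) (e h).
    by rewrite (psd_sym qP)// (linear_onD (psd_lin qP Wft)).
  have -> : h^-1 *: (h ^+ 2 * q (f' t + e h) (f' t + e h)
        + 2 * h * q (f' t + e h) (f t) + q (f t) (f t) - q (f t) (f t))
      - 2 * q (f t) (f' t)
    = 2 * q (f t) (e h) + h * q (f' t + e h) (f' t + e h).
    by rewrite qfe /GRing.scale/=; field.
  rewrite (le_trans (ler_normD _ _))// !normrM ger0_norm// lerD//.
    rewrite ler_pM2l// /k -(sqrtr_sqr (nrm (e h))) -sqrtrM; last first.
      by rewrite mulr_ge0// (psd_ge0 qP).
    rewrite -sqrtr_sqr ler_wsqrtr// (le_trans (psd_form_CS WL qP Wft We))//.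
    by rewrite -mulrA ler_wpM2l ?(psd_ge0 qP)// q_le.
  rewrite ler_wpM2l// ger0_norm ?(psd_ge0 qP)//.
  (* q (x + y) <= 2 (q x + q y), because 0 <= q (y - x) *)
  have quad2 c : q (c *: f' t + e h) (c *: f' t + e h) =
      c ^+ 2 * q (f' t) (f' t) + 2 * c * q (f' t) (e h) + q (e h) (e h).
    by rewrite (psd_form_quad c WL qP).
  have := quad2 1; rewrite scale1r => ->.
  have : 0 <= q ((-1) *: f' t + e h) ((-1) *: f' t + e h).
    by apply: (psd_ge0 qP); exact: WL.2.
  have := q_le _ We.
  by rewrite quad2; lra.
have cvgq : h^-1 *: (q (f (h *: 1 + t)) (f (h *: 1 + t)) - q (f t) (f t))
    @[h --> (0 : R)^'] --> (2 * q (f t) (f' t) : R).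
  apply/cvgrPdist_le => /= eps eps0.
  pose bound h := 2 * (k * `|nrm (e h)|)
    + `|h| * (2 * (q (f' t) (f' t) + C * nrm (e h) ^+ 2)).
  have bcvg : bound h @[h --> (0 : R)^'] --> (0 : R).
    suff : bound h @[h --> (0 : R)^'] --> 2 * (k * `|0 : R|)
        + `|0 : R| * (2 * (q (f' t) (f' t) + C * ((0 : R) * 0))).
      by rewrite normr0 !(mulr0, mul0r, addr0).
    have hcvg : h @[h --> (0 : R)^'] --> (0 : R).
      by move=> A; exact: nbhs_dnbhs.
    apply: cvgD.
      by do 2! (apply: cvgM; first exact: cvg_cst); exact: cvg_norm.
    apply: cvgM; first exact: cvg_norm.
    apply: cvgM; first exact: cvg_cst.
    apply: cvgD; first exact: cvg_cst.
    by apply: cvgM; [exact: cvg_cst|exact: cvgM].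
  near=> h.
  have h0 : h != 0 by near: h; exact: nbhs_dnbhs_neq.
  have th0 : 0 <= t + h by near: h.
  rewrite distrC [h *: 1]mulr1 [h + t]addrC (le_trans (diffE h h0 th0))//.
  rewrite -/(bound h) (le_trans (ler_norm _))//.
  by near: h; move/cvgr0Pnorm_le : bcvg; exact.
apply: DeriveDef; first by apply/cvg_ex; eexists; exact: cvgq.
exact: cvg_lim cvgq.
Unshelve. all: by end_near.
Qed.

Lemma C1_curve_sub (R : realType) (V : lmodType R) (nrm : V -> R)
    (S S' : set V) (f f' : R -> V) :
  S `<=` S' -> C1_curve nrm S f f' -> C1_curve nrm S' f f'.
Proof.
move=> sub [Sf df cf]; split=> // t t0.
by have [/sub ? /sub ?] := Sf t t0.
Qed.

Lemma C1_curve_in (R : realType) (V : lmodType R) (nrm : V -> R) (S : set V)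
    (f f' : R -> V) (t : R) :
  C1_curve nrm S f f' -> 0 <= t -> S (f t) /\ S (f' t).
Proof. by move=> [Sf _ _]; exact: Sf. Qed.


(** * Weighted inner products on the interval *)

Definition wprod (R : realType) (L : R) (m f g : R -> R) : R :=
  \int[lebesgue_measure]_(x in `]0, L[) (m x * f x * g x).

Section Weighted.
Context (R : realType) (L : R).
Implicit Types (m f g : R -> R).

Lemma Ck_closed_continuous k f :
  Ck_closed L k f -> {within `[0, L], continuous f}.
Proof.
move=> [g [fg gc _]]; have := gc 0%N isT.
apply: subspace_eq_continuous => x; rewrite inE/= => xL.
exact/esym/fg.
Qed.

Lemma L2_lin a f g : L2 L f -> L2 L g -> L2 L (a *: f + g).
Proof.
have le12 : (1 <= 2%:E :> \bar R)%E by rewrite lee_fin ler1n.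
rewrite /L2 => f2 g2.
have -> : (a *: f + g) \_ `]0, L[ = a *: (f \_ `]0, L[) + g \_ `]0, L[.
  apply/funext => x; rewrite /patch /=.
  rewrite [in RHS]/GRing.add/= [in RHS]/GRing.scale/=.
  case: ifP => // _.
  by rewrite -[point]/(0 : R) scaler0 addr0.
exact: ((Lfun_submod_closed _ le12).2 a _ _ f2 g2).
Qed.

Lemma cst1_continuous : {within `[0, L], continuous (cst 1 : R -> R)}.
Proof. by apply: continuous_subspaceT => x; exact: cvg_cst. Qed.

Lemma integrable_wprod m f g : {within `[0, L], continuous m} ->
  L2 L f -> L2 L g ->
  lebesgue_measure.-integrable `]0, L[ (EFin \o (fun x => m x * f x * g x)).
Proof.
move=> mc f2 g2.
have sub : `]0, L[ `<=` `[0, L] by move=> x /=; exact: subset_itv_oo_cc.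
have mm : measurable_fun `]0, L[ m.
  apply: (@measurable_funS _ _ _ _ `[0, L]) => //.
  by apply: subspace_continuous_measurable_fun.
have mb : [bounded m x | x in `]0, L[].
  have /compact_bounded [M [Mr Mb]] :=
    continuous_compact mc (@segment_compact _ 0 L).
  exists M; split=> // y My x xL; apply: (Mb y My); exists x => //.
  exact: sub.
have fg : lebesgue_measure.-integrable `]0, L[ (EFin \o (f \* g)).
  apply/integrable_mkcond => //.
  have /Lfun1_integrable := Lfun2_mul_Lfun1 f2 g2.
  apply: eq_integrable => // x _ /=; rewrite /patch.
  by case: ifP => //; rewrite mulr0.
have : lebesgue_measure.-integrable `]0, L[
    ((EFin \o m) \* (EFin \o (f \* g)%R))%E by exact: integrableMr.
by apply: eq_integrable => // x _ /=; rewrite -mulrA.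
Qed.

Lemma integrable_wprodZ a m f g : {within `[0, L], continuous m} ->
  L2 L f -> L2 L g -> lebesgue_measure.-integrable `]0, L[
    (EFin \o (fun x => a * (m x * f x * g x))).
Proof.
move=> mc f2 g2; have : lebesgue_measure.-integrable `]0, L[
    (fun x => a%:E * (m x * f x * g x)%:E)%E.
  by apply: integrableZl => //; exact: integrable_wprod.
by apply: eq_integrable.
Qed.

Lemma wprod_lin m f : {within `[0, L], continuous m} -> L2 L f ->
  forall a g h, L2 L g -> L2 L h ->
  wprod L m f (a *: g + h) = a * wprod L m f g + wprod L m f h.
Proof.
move=> mc f2 a g h g2 h2; rewrite /wprod.
rewrite -RintegralZl//; last exact: integrable_wprod.
rewrite -RintegralD//; last exact: integrable_wprod.
  apply: eq_Rintegral => x _ /=.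
  by rewrite mulrDr; congr (_ + _); rewrite mulrCA.
exact: integrable_wprodZ.
Qed.

Lemma wprodC m f g : wprod L m f g = wprod L m g f.
Proof. by apply: eq_Rintegral => x _; rewrite mulrAC. Qed.

Lemma wprod_ge0 m f : (forall x, x \in `]0, L[ -> 0 <= m x) ->
  0 <= wprod L m f f.
Proof.
move=> m0; apply: Rintegral_ge0 => x xL.
by rewrite -mulrA mulr_ge0// ?m0// -expr2 sqr_ge0.
Qed.

(** The weight attains a maximum on the closed interval. *)
Lemma wprod1_eq0 m f : 0 < L -> {within `[0, L], continuous m} ->
  (forall x, x \in `]0, L[ -> 0 <= m x) -> L2 L f ->
  wprod L (cst 1) f f = 0 -> wprod L m f f = 0.
Proof.
move=> L0 mc m0 f2 f0; apply/eqP; rewrite eq_le wprod_ge0// andbT.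
have [c _ cmax] := EVT_max (ltW L0) mc.
have cst1 := cst1_continuous.
rewrite -(mulr0 (m c)) -f0 /wprod -RintegralZl//; last first.
  exact: integrable_wprod.
apply: le_Rintegral => //; first exact: integrable_wprod.
  exact: integrable_wprodZ.
move=> x xL; rewrite /= mul1r -!mulrA ler_wpM2r//.
  by rewrite -expr2 sqr_ge0.
by apply: cmax; exact: subset_itv_oo_cc xL.
Qed.

(** If [f L] were nonzero, [f] would not vanish on some interval left of [L],
    which has positive measure. *)
Lemma wprod1_eq0_end f : 0 < L -> {within `[0, L], continuous f} -> L2 L f ->
  wprod L (cst 1) f f = 0 -> f L = 0.
Proof.
move=> L0 fc f2 f0; apply/eqP/negPn/negP => fL0.
have int := integrable_wprod cst1_continuous f2 f2.
have int0 : (\int[lebesgue_measure]_(x in `]0%R, L[)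
    `|(cst 1 x * f x * f x)%:E|)%E = 0%E.
  rewrite -[RHS](_ : (wprod L (cst 1) f f)%:E = _); last by rewrite f0.
  rewrite /wprod /Rintegral fineK; last exact: integrable_fin_num.
  apply: eq_integral => x _ /=; rewrite ger0_norm//.
  by rewrite mul1r -expr2 sqr_ge0.
have mD : measurable (`]0, L[ : set (measurableTypeR R)) by [].
have [N [mN N0 subN]] :=
  (ae_eq_integral_abs _ mD (measurable_int _ int)).1 int0.
have [_ _ fL] := (continuous_within_itvP f L0).1 fc.
have : \forall x \near L^'-, f x != 0 by exact: (cvgr_neq0 _ fL fL0).
move=> [d /= d0 dP].
pose a := Num.max 0 (L - d).
have aL : a < L by rewrite gt_max L0 ltrBlDr ltrDl.
have : (lebesgue_measure `]a, L[ <= lebesgue_measure N)%E.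
  apply: le_measure; rewrite ?inE// => x /=; rewrite in_itv/= => /andP[ax xL].
  move: ax; rewrite gt_max => /andP[x0 xd].
  have fx0 : f x != 0.
    apply: dP => //=.
    by rewrite ger0_norm ?subr_ge0 ?(ltW xL)// ltrBlDr -ltrBlDl.
  apply: subN => /=; rewrite in_itv/= x0 xL => /(_ isT) [] /eqP.
  by rewrite mul1r mulf_eq0 orbb (negbTE fx0).
rewrite N0 lebesgue_measure_itv/= lte_fin aL -EFinD lee_fin.
by rewrite subr_le0 leNgt aL.
Qed.
End Weighted.

(** * The inner product of H^2 on jets *)

Section Jets.
Context (R : realType) (L : R).
Hypothesis L0 : 0 < L.

(** A linear space containing H^2 on which the forms make sense: square
    integrability makes their integrals additive, and continuity ties the values
    at the tip to those inside the interval. *)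
Definition jets : set (jet R) :=
  [set v | [/\ L2 L (fn v), L2 L (dx v), L2 L (dxx v),
    {within `[0, L], continuous (fn v)} &
    {within `[0, L], continuous (dx v)}]].

Definition h2prod (u v : jet R) : R :=
  wprod L (cst 1) (fn u) (fn v) + wprod L (cst 1) (dx u) (dx v)
  + wprod L (cst 1) (dxx u) (dxx v).

Lemma L2_0 : L2 L (0 : R -> R).
Proof.
have le12 : (1 <= 2%:E :> \bar R)%E by rewrite lee_fin ler1n.
rewrite /L2; have -> : (0 : R -> R) \_ `]0, L[ = 0.
  by apply/funext => x; rewrite /patch; case: ifP.
exact: (Lfun_submod_closed _ le12).1.
Qed.

Lemma jets_closed : lin_closed jets.
Proof.
split.
  split; try exact: L2_0; by apply: continuous_subspaceT => x; exact: cvg_cst.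
move=> a u v [u0 u1 u2 uc uc'] [v0 v1 v2 vc vc'].
split.
- exact: (L2_lin a u0 v0).
- exact: (L2_lin a u1 v1).
- exact: (L2_lin a u2 v2).
- move=> x; apply: (@continuousD _ _ _ (a *: fn u : subspace _ -> _));
    last exact: vc.
  by apply: continuousZ; [exact: cst_continuous|exact: uc].
- move=> x; apply: (@continuousD _ _ _ (a *: dx u : subspace _ -> _));
    last exact: vc'.
  by apply: continuousZ; [exact: cst_continuous|exact: uc'].
Qed.

Lemma psd_form_wprod (m : R -> R) (D : jet R -> R -> R) :
  {within `[0, L], continuous m} -> (forall x, x \in `]0, L[ -> 0 <= m x) ->
  (forall a u v, D (a *: u + v) = a *: D u + D v) ->
  (forall v, jets v -> L2 L (D v)) ->
  psd_form jets (fun u v => wprod L m (D u) (D v)).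
Proof.
move=> mc m0 DL D2; split=> [u Su a v w Sv Sw|u v Su Sv|u Su].
- by rewrite DL wprod_lin//; exact: D2.
- exact: wprodC.
- exact: wprod_ge0.
Qed.

Lemma h2prod_psd : psd_form jets h2prod.
Proof.
apply: psd_formD; [apply: psd_formD|]; apply: psd_form_wprod => //;
  by [exact: cst1_continuous|move=> v []].
Qed.

Lemma normH2E v : normH2 L v = Num.sqrt (h2prod v v).
Proof.
rewrite /normH2 /h2prod /wprod; congr (Num.sqrt (_ + _ + _));
  by apply: eq_Rintegral => x _ /=; rewrite mul1r expr2.
Qed.

Lemma h2prod_eq0 v : jets v -> h2prod v v = 0 ->
  [/\ wprod L (cst 1) (fn v) (fn v) = 0, wprod L (cst 1) (dx v) (dx v) = 0 &
      wprod L (cst 1) (dxx v) (dxx v) = 0].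
Proof.
move=> Sv; rewrite /h2prod.
have w0 f : 0 <= wprod L (cst 1) f f by exact: wprod_ge0.
have := w0 (fn v); have := w0 (dx v); have := w0 (dxx v).
by move=> *; split; lra.
Qed.

(** Together with [span_mod_bounded], this makes the values at the tip
    continuous on the discrete space. *)
Lemma null_end v : jets v -> h2prod v v = 0 -> fn v L = 0 /\ dx v L = 0.
Proof.
move=> Sv /(h2prod_eq0 Sv)[v0 v1 _]; have [f2 d2 _ fc dc] := Sv.
by split; exact: wprod1_eq0_end.
Qed.

Lemma galerkin_space_sub N (w : 'I_N -> jet R) : (forall j, jets (w j)) ->
  galerkin_space L w `<=` span_mod jets h2prod w.
Proof.
move=> Sw v [[[v0 v1 v2 _ _ vc vc'] _ _] [a va]].
have Sv : jets v by split.
split=> //; exists a; move: va; rewrite normH2E => /eqP.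
rewrite sqrtr_eq0 => le0; apply/eqP; rewrite eq_le le0.
apply: (psd_ge0 h2prod_psd); apply: (lin_closedB jets_closed) => //.
exact: (lin_closed_sum _ jets_closed).
Qed.

End Jets.


(** * Stiffness and mass forms of the beam *)

Section Beam.
Context (R : realType) (B : beam R).
Hypothesis hB : beam_ok B.
Let L := len B.

Definition stiffness (u v : jet R) : R :=
  wprod L (Lam B) (dxx u) (dxx v)
  + (k1 B * dx u L * dx v L + k2 B * fn u L * fn v L).

Definition mass (u v : jet R) : R :=
  wprod L (mu B) (fn u) (fn v)
  + (tipM B * fn u L * fn v L + tipJ B * dx u L * dx v L).

Lemma Lam_ge0_in x : x \in `]0, L[ -> 0 <= Lam B x.
Proof. by move=> xL; apply/ltW/(Lam_gt0 hB); exact: subset_itv_oo_cc xL. Qed.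

Lemma mu_ge0_in x : x \in `]0, L[ -> 0 <= mu B x.
Proof. by move=> xL; apply/ltW/(mu_gt0 hB); exact: subset_itv_oo_cc xL. Qed.

Lemma stiffness_psd : psd_form (jets L) stiffness.
Proof.
apply: psd_formD; last first.
  by apply: psd_formD; apply: psd_form_sqr => //; apply: ltW;
    [exact: k1_gt0|exact: k2_gt0].
apply: psd_form_wprod => [||//|v []//].
- exact: Ck_closed_continuous (Lam_C4 hB).
- exact: Lam_ge0_in.
Qed.

Lemma mass_psd : psd_form (jets L) mass.
Proof.
apply: psd_formD; last first.
  by apply: psd_formD; apply: psd_form_sqr => //; apply: ltW;
    [exact: tipM_gt0|exact: tipJ_gt0].
apply: psd_form_wprod => [||//|v []//].
- exact: Ck_closed_continuous (mu_C4 hB).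
- exact: mu_ge0_in.
Qed.

Lemma stiffness_null v : jets L v -> h2prod L v v = 0 -> stiffness v v = 0.
Proof.
move=> Sv v0; have [fL dL] := null_end (len_gt0 hB) Sv v0.
have [_ _ d0] := h2prod_eq0 Sv v0; have [_ _ d2 _ _] := Sv.
rewrite /stiffness fL dL !mulr0 !addr0; apply: wprod1_eq0 => //.
- exact: len_gt0 hB.
- exact: Ck_closed_continuous (Lam_C4 hB).
- exact: Lam_ge0_in.
Qed.

Lemma mass_null v : jets L v -> h2prod L v v = 0 -> mass v v = 0.
Proof.
move=> Sv v0; have [fL dL] := null_end (len_gt0 hB) Sv v0.
have [f0 _ _] := h2prod_eq0 Sv v0; have [f2 _ _ _ _] := Sv.
rewrite /mass fL dL !mulr0 !addr0; apply: wprod1_eq0 => //.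
- exact: len_gt0 hB.
- exact: Ck_closed_continuous (mu_C4 hB).
- exact: mu_ge0_in.
Qed.
End Beam.


(** * Storage form of a controller *)

Section Controller.
Context (R : realType) (r : nat).
Implicit Types (x y z : 'cV[R]_r) (P : 'M[R]_r).

Lemma dotE x y : dot x y = (x^T *m y) 0 0.
Proof. by rewrite mxE; apply: eq_bigr => i _; rewrite mxE. Qed.

Lemma dotC x y : dot x y = dot y x.
Proof. by apply: eq_bigr => i _; rewrite mulrC. Qed.

Lemma dot_lin x a y z : dot x (a *: y + z) = a * dot x y + dot x z.
Proof. by rewrite !dotE mulmxDr -scalemxAr !mxE. Qed.

Lemma dotZr x a y : dot x (a *: y) = a * dot x y.
Proof. by rewrite !dotE -scalemxAr !mxE. Qed.

Lemma dot_mulmx x P y : dot x (P *m y) = dot (P^T *m x) y.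
Proof. by rewrite !dotE trmx_mul trmxK mulmxA. Qed.

Lemma dot_ge0 x : 0 <= dot x x.
Proof. by apply: sumr_ge0 => i _; rewrite -expr2 sqr_ge0. Qed.

Lemma dot_eq0 x : dot x x = 0 -> x = 0.
Proof.
move/eqP; rewrite psumr_eq0; last by move=> i _; rewrite -expr2 sqr_ge0.
move/allP => x0; apply/colP => i; rewrite mxE; apply/eqP.
by have := x0 i (mem_index_enum i); rewrite -expr2 sqrf_eq0.
Qed.

Lemma setT_closed : lin_closed [set: 'cV[R]_r].
Proof. by []. Qed.

Lemma dot_psd : psd_form [set: 'cV[R]_r] (@dot R r).
Proof.
split=> [x _ a y z _ _|x y _ _|x _]; [exact: dot_lin|exact: dotC|].
exact: dot_ge0.
Qed.

Variable C : controller R r.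
Hypothesis hC : controller_ok C.

Definition storage x y : R := dot x (cP C *m y).

Lemma storage_psd : psd_form [set: 'cV[R]_r] storage.
Proof.
split=> [x _ a y z _ _|x y _ _|x _]; rewrite /storage.
- by rewrite mulmxDr -scalemxAr dot_lin.
- by rewrite dot_mulmx (cP_sym hC) dotC.
- have [->|x0] := eqVneq x 0; first by rewrite mulmx0 dot_ge0.
  exact/ltW/(cP_posdef hC).
Qed.

(** The case of [span_mod_bounded] in which [b] is the Euclidean inner product
    and [w] the standard basis. *)
Lemma storage_bounded :
  exists2 K : R, 0 <= K & forall x, storage x x <= K * norm2 x ^+ 2.
Proof.
pose e (i : 'I_r) : 'cV[R]_r := delta_mx i 0.
have sumE (a : 'I_r -> R) : \sum_i a i *: e i = \col_i a i.
  apply/colP => j; rewrite summxE (bigD1 j)//= big1 => [|i ij].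
    by rewrite !mxE !eqxx mulr1 addr0.
  by rewrite !mxE eq_sym (negbTE ij) mulr0.
have e_indep (a : 'I_r -> R) :
    dot (\sum_i a i *: e i) (\sum_i a i *: e i) = 0 -> forall i, a i = 0.
  move=> /dot_eq0; rewrite sumE => /colP a0 i.
  by have := a0 i; rewrite !mxE.
have storage_null n : [set: 'cV[R]_r] n -> dot n n = 0 -> storage n n = 0.
  by move=> _ /dot_eq0 ->; rewrite /storage mulmx0 dotE mulmx0 mxE.
have [K K0 Kle] := span_mod_bounded setT_closed dot_psd
  (fun=> I : [set: 'cV[R]_r] _) e_indep storage_psd storage_null.
exists K => // x; rewrite /norm2 sqr_sqrtr ?dot_ge0//; apply: Kle.
split=> //; exists (fun i => x i 0); rewrite sumE.
have -> : \col_i x i 0 = x by apply/colP => i; rewrite mxE.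
by rewrite subrr dotE mulmx0 mxE.
Qed.

(** Passivity of the controller.  The Lyapunov equation gives
    [2 z^T P A z = - (z.q)^2 - eps z^T P z], and the relation for [P b] gives
    [z^T P b y = (c.z) y - deltat (z.q) y]; the term [deltat^2 y^2 / 2] that
    completes the square equals [(d - delta) y^2]. *)
Lemma storage_rate z (y : R) :
  storage z (cA C *m z + y *: cb C) =
  - (ceps C / 2) * dot z (cP C *m z)
  - 2^-1 * (dot z (cq C) + cdeltat C * y) ^+ 2
  - cdelta C * y ^+ 2 + cd C * y ^+ 2 + dot (cc C) z * y.
Proof.
have lyap : 2 * dot z (cP C *m (cA C *m z)) =
    - dot z (cq C) ^+ 2 - ceps C * dot z (cP C *m z).
  have -> : 2 * dot z (cP C *m (cA C *m z)) =
      dot z ((cP C *m cA C + (cA C)^T *m cP C) *m z).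
    rewrite mulmxDl -[X in dot z (X + _)]scale1r dot_lin mul1r !mulmxA.
    rewrite [X in _ = _ + X]dot_mulmx trmx_mul trmxK (cP_sym hC) dotC.
    by rewrite mulr2n mulrDl mul1r.
  rewrite (cP_lyapunov hC).
  have -> : (- (cq C *m (cq C)^T) - ceps C *: cP C) *m z =
      (- dot (cq C) z) *: cq C + (- ceps C) *: (cP C *m z).
    rewrite mulmxBl mulNmx -scalemxAl !scaleNr; congr (- _ - _).
    by rewrite -mulmxA [(cq C)^T *m z]mx11_scalar mul_mx_scalar dotE.
  by rewrite dot_lin dotZr (dotC (cq C)); ring.
have dt : cdeltat C ^+ 2 = 2 * (cd C - cdelta C).
  by rewrite sqr_sqrtr// mulr_ge0// subr_ge0 (cd_ge hC).
have Pb : dot z (cP C *m cb C) = dot (cc C) z - cdeltat C * dot z (cq C).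
  by rewrite (cP_b hC) addrC -scaleNr dot_lin (dotC (cc C)); ring.
rewrite /storage mulmxDr -scalemxAr [_ + y *: _]addrC dot_lin Pb.
have -> : dot z (cP C *m (cA C *m z)) =
  2^-1 * (- dot z (cq C) ^+ 2 - ceps C * dot z (cP C *m z)).
  by rewrite -lyap; field.
by rewrite sqrrD exprMn dt; field.
Qed.
End Controller.

(** * Dissipation along semi-discrete solutions *)

Section Dissipation.
Context (R : realType) (r N : nat) (B : beam R) (C1 C2 : controller R r)
  (w : 'I_N -> jet R) (u ut utt : R -> jet R)
  (z1 z1t z2 z2t : R -> 'cV[R]_r).
Hypotheses (hB : beam_ok B) (hC1 : controller_ok C1) (hC2 : controller_ok C2)
  (hw : galerkin_basis (len B) w)
  (hsol : semidiscrete_solution B C1 C2 w u ut utt z1 z1t z2 z2t).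
Let L := len B.
Let Wh := span_mod (jets L) (h2prod L) w.

Lemma basis_jets j : jets L (w j).
Proof. by have [[v0 v1 v2 _ _ vc vc'] _ _] := hw.1 j. Qed.

Lemma basis_indep (a : 'I_N -> R) :
  h2prod L (\sum_(j < N) a j *: w j) (\sum_(j < N) a j *: w j) = 0 ->
  forall j, a j = 0.
Proof. by move=> a0; apply: hw.2; rewrite normH2E a0 sqrtr0. Qed.

Lemma Wh_jets : Wh `<=` jets L.
Proof. by move=> v []. Qed.

Lemma Wh_closed : lin_closed Wh.
Proof. exact: (span_mod_closed (jets_closed _) (h2prod_psd _) basis_jets). Qed.

Lemma u_curve : C1_curve (normH2 L) Wh u ut.
Proof. exact: C1_curve_sub (galerkin_space_sub basis_jets) (sol_u hsol).1. Qed.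

Lemma ut_curve : C1_curve (normH2 L) Wh ut utt.
Proof. exact: C1_curve_sub (galerkin_space_sub basis_jets) (sol_u hsol).2. Qed.

Lemma is_derive_Wh (q : jet R -> jet R -> R) (f f' : R -> jet R) (t : R) :
  psd_form (jets L) q ->
  (forall v, jets L v -> h2prod L v v = 0 -> q v v = 0) ->
  C1_curve (normH2 L) Wh f f' -> 0 < t ->
  is_derive t 1 (fun s => q (f s) (f s)) (2 * q (f t) (f' t)).
Proof.
move=> qP qnull fC t0.
have [K K0 Kle] := span_mod_bounded (jets_closed L) (h2prod_psd L) basis_jets
  basis_indep qP qnull.
apply: (is_derive_psd_form Wh_closed (psd_form_sub Wh_jets qP) K0 _ fC t0).
move=> v Wv; rewrite normH2E sqr_sqrtr; first exact: Kle.
by apply: (psd_ge0 (h2prod_psd L)); exact: Wh_jets.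
Qed.

Lemma is_derive_storage (C : controller R r) (z zt : R -> 'cV[R]_r) (t : R) :
  controller_ok C -> C1_curve (@norm2 R r) setT z zt -> 0 < t ->
  is_derive t 1 (fun s => storage C (z s) (z s)) (2 * storage C (z t) (zt t)).
Proof.
move=> hC zC t0; have [K K0 Kle] := storage_bounded hC.
exact: (is_derive_psd_form (@setT_closed _ _) (storage_psd hC) K0 _ zC t0).
Qed.

(** The left-hand side is linear in the test element and vanishes on the null
    space, so it is determined by its values on the basis. *)
Lemma galerkin_Wh t v : 0 < t -> Wh v ->
  stiffness B (u t) v + mass B (utt t) v
  + cd C1 * dx (ut t) L * dx v L + cd C2 * fn (ut t) L * fn v L
  + dot (cc C1) (z1 t) * dx v L + dot (cc C2) (z2 t) * fn v L = 0.
Proof.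
move=> t0; have [Wu _] := C1_curve_in u_curve (ltW t0).
have [_ Wutt] := C1_curve_in ut_curve (ltW t0).
have Su := Wh_jets Wu; have Sutt := Wh_jets Wutt.
pose F v := stiffness B (u t) v + mass B (utt t) v
  + cd C1 * dx (ut t) L * dx v L + cd C2 * fn (ut t) L * fn v L
  + dot (cc C1) (z1 t) * dx v L + dot (cc C2) (z2 t) * fn v L.
apply: (@span_mod_linear0 _ _ _ _ _ _ (jets_closed L) basis_jets F)
  => [a f g Sf Sg|j|n Sn n0].
- rewrite /F (psd_lin (stiffness_psd hB) Su)// (psd_lin (mass_psd hB) Sutt)//.
  have -> : dx (a *: f + g) L = a * dx f L + dx g L by [].
  have -> : fn (a *: f + g) L = a * fn f L + fn g L by [].
  by ring.
- by rewrite -[RHS](sol_eq hsol j t0) /F /stiffness /mass /wprod -/L /=; ring.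
- have [fL dL] := null_end (len_gt0 hB) Sn n0.
  have sn := psd_form_null (jets_closed L) (stiffness_psd hB) Sn Su
    (stiffness_null hB Sn n0).
  have mn := psd_form_null (jets_closed L) (mass_psd hB) Sn Sutt
    (mass_null hB Sn n0).
  rewrite /F fL dL (psd_sym (stiffness_psd hB) Su Sn) sn.
  by rewrite (psd_sym (mass_psd hB) Sutt Sn) mn !mulr0 !addr0.
Qed.

Lemma energyE s : 0 <= s ->
  energy B C1 C2 u ut z1 z2 s =
  2^-1 * (stiffness B (u s) (u s) + mass B (ut s) (ut s)
    + storage C1 (z1 s) (z1 s) + storage C2 (z2 s) (z2 s)).
Proof.
move=> s0.
have [/Wh_jets[_ _ u2 _ _] /Wh_jets[ut0 _ _ _ _]] := C1_curve_in u_curve s0.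
rewrite /energy -/L /stiffness /mass /storage.
have -> : \int[lebesgue_measure]_(x in `]0, L[)
    (Lam B x * dxx (u s) x ^+ 2 + mu B x * fn (ut s) x ^+ 2) =
  wprod L (Lam B) (dxx (u s)) (dxx (u s))
  + wprod L (mu B) (fn (ut s)) (fn (ut s)).
  rewrite /wprod -RintegralD//; last 2 first.
  - exact: (integrable_wprod (Ck_closed_continuous (Lam_C4 hB))).
  - exact: (integrable_wprod (Ck_closed_continuous (mu_C4 hB))).
  by apply: eq_Rintegral => x _; rewrite !expr2 !mulrA.
by rewrite -/L; field.
Qed.
End Dissipation.

Unset Implicit Arguments.

Theorem theorem6 (R : realType) (r N : nat) (B : beam R)
    (C1 C2 : controller R r) (w : 'I_N -> jet R)
    (u ut utt : R -> jet R) (z1 z1t z2 z2t : R -> 'cV[R]_r)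
    (hr : (0 < r)%N) (hB : beam_ok B)
    (hC1 : controller_ok C1) (hC2 : controller_ok C2)
    (hw : galerkin_basis (len B) w)
    (hsol : semidiscrete_solution B C1 C2 w u ut utt z1 z1t z2 z2t)
    (t : R) (ht : 0 < t) :
  let uxtL := dx (ut t) (len B) in
  let utL := fn (ut t) (len B) in
  let rate :=
    - (ceps C1 / 2) * dot (z1 t) (cP C1 *m z1 t)
    - 2^-1 * (dot (z1 t) (cq C1) + cdeltat C1 * uxtL) ^+ 2
    - cdelta C1 * uxtL ^+ 2
    - (ceps C2 / 2) * dot (z2 t) (cP C2 *m z2 t)
    - 2^-1 * (dot (z2 t) (cq C2) + cdeltat C2 * utL) ^+ 2
    - cdelta C2 * utL ^+ 2 in
  is_derive t 1 (energy B C1 C2 u ut z1 z2) rate /\ rate <= 0.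
Proof.
move=> uxtL utL rate; split; last first.
  have zP1 := psd_ge0 (storage_psd hC1) (I : [set: _] (z1 t)).
  have zP2 := psd_ge0 (storage_psd hC2) (I : [set: _] (z2 t)).
  rewrite /storage in zP1 zP2.
  have := mulr_ge0 (ltW (ceps_gt0 hC1)) zP1.
  have := mulr_ge0 (ltW (ceps_gt0 hC2)) zP2.
  have := mulr_ge0 (ltW (cdelta_gt0 hC1)) (sqr_ge0 uxtL).
  have := mulr_ge0 (ltW (cdelta_gt0 hC2)) (sqr_ge0 utL).
  have := sqr_ge0 (dot (z1 t) (cq C1) + cdeltat C1 * uxtL).
  have := sqr_ge0 (dot (z2 t) (cq C2) + cdeltat C2 * utL).
  by rewrite /rate; lra.
have near_t : \forall s \near t, 2^-1 * (stiffness B (u s) (u s)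
    + mass B (ut s) (ut s) + storage C1 (z1 s) (z1 s)
    + storage C2 (z2 s) (z2 s)) = energy B C1 C2 u ut z1 z2 s.
  near=> s; rewrite (energyE hB hw hsol)//; apply: ltW.
  by near: s; exact: lt_nbhsr.
apply: near_eq_is_derive near_t _.
have du := is_derive_Wh hw (stiffness_psd hB) (stiffness_null hB)
  (u_curve hw hsol) ht.
have dut := is_derive_Wh hw (mass_psd hB) (mass_null hB) (ut_curve hw hsol) ht.
have dz1 := is_derive_storage hC1 (sol_z1 hsol) ht.
have dz2 := is_derive_storage hC2 (sol_z2 hsol) ht.
have dE :=
  is_deriveZ (2^-1) (is_deriveD (is_deriveD (is_deriveD du dut) dz1) dz2).
refine (is_derive_eq dE _).
have [Wu Wut] := C1_curve_in (u_curve hw hsol) (ltW ht).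
have [_ Wutt] := C1_curve_in (ut_curve hw hsol) (ltW ht).
have := galerkin_Wh hB hw hsol ht Wut.
rewrite (psd_sym (mass_psd hB) (Wh_jets Wutt) (Wh_jets Wut)).
rewrite (sol_ode1 hsol ht) (sol_ode2 hsol ht) !storage_rate//.
rewrite -/uxtL -/utL /rate /GRing.scale/=.
(* the two sides differ by the Galerkin identity tested with ut t *)
move=> gal; apply/eqP; rewrite -subr_eq0; apply/eqP; rewrite -gal; field.
Unshelve. all: by end_near.
Qed.
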